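(* Let $k$ be an algebraically closed field, let $X$ be a variety over $k$, and let $\eta$ be the generic point of $X$. A sequence $x_n\in X$, $n\geq 0$, of (scheme-theoretic) points is generic if and only if $$\lim_{n\to\infty}\delta_{x_n}=\delta_{\eta}$$ in $\mathcal{M}(|X|)$ with the weak-$\ast$ topology.
   Context: A variety is an irreducible, reduced, separated scheme of finite type over a field. A sequence $x_n\in X$, $n\ge 0$, is generic if every subsequence $x_{n_i}$, $i\ge 0$, is Zariski dense in $X$. $|X|$ denotes the underlying set of the scheme $X$ endowed with the constructible topology (generated by the constructible subsets); it is compact Hausdorff. $\mathcal{M}(|X|)$ is the space of (positive) Radon measures on $|X|$ with the weak-$\ast$ topology: $\mu_n\to\mu$ iff $\int\phi\,d\mu_n\to\int\phi\,d\mu$ for every continuous $\phi:|X|\to\mathbb{R}$. $\delta_x$ is the Dirac measure at $x$. *)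

(* Defs.v *)
From HB Require Import structures.
From mathcomp Require Import all_boot all_order all_algebra.
From mathcomp Require Import finmap.
From mathcomp Require Import all_classical all_reals all_analysis.

Set Implicit Arguments.
Unset Strict Implicit.
Unset Printing Implicit Defensive.

Import Order.TTheory GRing.Theory Num.Theory.
Import numFieldNormedType.Exports.

Local Open Scope classical_set_scope.
Local Open Scope ring_scope.

Record opens (X : topologicalType) := Opens {
  oset :> set X;
  oset_open : open oset }.

Definition opensT (X : topologicalType) : opens X := Opens (@openT X).

Definition opens_preimage (X Y : topologicalType) (f : X -> Y)
    (fc : continuous f) (V : opens Y) : opens X :=
  Opens (proj1 (continuousP f) fc _ (oset_open V)).

(* Commutative rings are [comPzRingType]s, which may be zero, as the ring of
   sections over the empty set must be. The compatibility condition for gluing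
   ranges over all open [U] inside both [V i] and [V j]; this amounts to the
   condition on their intersection. *)
Record ringed_space := RingedSpace {
  rs_top :> topologicalType;
  sections : opens rs_top -> comPzRingType;
  res : forall U V : opens rs_top, V `<=` U ->
    {rmorphism sections U -> sections V};
  res_id : forall (U : opens rs_top) (UU : U `<=` U) (s : sections U),
    res UU s = s;
  res_res : forall (U V W : opens rs_top) (VU : V `<=` U) (WV : W `<=` V)
    (WU : W `<=` U) (s : sections U), res WV (res VU s) = res WU s;
  res_inj : forall (U : opens rs_top) (I : Type) (V : I -> opens rs_top)
    (VU : forall i, V i `<=` U) (s t : sections U),
    U `<=` \bigcup_i V i ->
    (forall i, res (VU i) s = res (VU i) t) -> s = t;
  res_glue : forall (U : opens rs_top) (I : Type) (V : I -> opens rs_top)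
    (VU : forall i, V i `<=` U) (s : forall i, sections (V i)),
    U `<=` \bigcup_i V i ->
    (forall i j (W : opens rs_top) (Wi : W `<=` V i) (Wj : W `<=` V j),
      res Wi (s i) = res Wj (s j)) ->
    exists t : sections U, forall i, res (VU i) t = s i }.

Definition invertible (A : comPzRingType) (a : A) := exists b, a * b = 1.

(* The germ of [s] at [x] is a unit of the stalk at [x]. *)
Definition germ_unit (X : ringed_space) (x : X) (U : opens X)
    (s : sections U) :=
  exists (V : opens X) (VU : V `<=` U), oset V x /\ invertible (res VU s).

Definition prime_ideal (A : comPzRingType) (p : set A) :=
  [/\ p 0, (forall a b, p a -> p b -> p (a + b)),
      (forall a b, p b -> p (a * b)), ~ p 1
    & forall a b, p (a * b) -> p a \/ p b].

Record spec (A : comPzRingType) := Spec {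
  ideal_of :> set A;
  ideal_of_prime : prime_ideal ideal_of }.

HB.instance Definition _ (A : comPzRingType) := gen_eqMixin (spec A).
HB.instance Definition _ (A : comPzRingType) := gen_choiceMixin (spec A).

Definition basic_open (A : comPzRingType) (f : A) : set (spec A) :=
  [set p | ~ ideal_of p f].

Section zariski.
Variable A : comPzRingType.

Definition zariski_open : set (set (spec A)) :=
  [set W | exists S : set A, W = [set p | ~ (S `<=` ideal_of p)]].

Lemma zariski_openT : zariski_open setT.
Proof.
exists setT; apply/seteqP; split => // p _ /= /(_ 1 Logic.I).
by case: (ideal_of_prime p).
Qed.

Lemma zariski_openI : setI_closed zariski_open.
Proof.
move=> _ _ [S ->] [S' ->].
exists [set c | exists a b, [/\ S a, S' b & c = a * b]].
apply/seteqP; split => p /=.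
  move=> [/existsNP[a /not_implyP[Sa pa]] /existsNP[b /not_implyP[Sb pb]]].
  case: (ideal_of_prime p) => _ _ _ _ pM pSS'.
  by have /pM[/pa|/pb] : ideal_of p (a * b) by apply: pSS'; exists a, b.
case: (ideal_of_prime p) => _ _ pM _ _ pSS'; split => pS; apply: pSS'.
  by move=> _ [a [b [/pS pa _ ->]]]; rewrite mulrC; exact: pM.
by move=> _ [a [b [_ /pS pb ->]]]; exact: pM.
Qed.

Lemma zariski_open_bigU (I : Type) (W : I -> set (spec A)) :
  (forall i, zariski_open (W i)) -> zariski_open (\bigcup_i W i).
Proof.
move=> /choice[S WS]; exists (\bigcup_i S i); apply/seteqP; split => p /=.
  by move=> [i _]; rewrite WS => + pS; apply => a Sa; apply: pS; exists i.
move=> /existsNP[a /not_implyP[[i _ Sa] pa]]; exists i => //.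
by rewrite WS => /(_ _ Sa).
Qed.

HB.instance Definition _ := isOpenTopological.Build (spec A)
  zariski_openT zariski_openI zariski_open_bigU.

Lemma zariski_openE (W : set (spec A)) : open W <-> zariski_open W.
Proof. by []. Qed.

End zariski.

(* [phi : A -> B] exhibits [B] as the localization of [A] at the powers of
   [f]. *)
Definition is_localization (A B : comPzRingType) (f : A) (phi : A -> B) :=
  [/\ invertible (phi f),
      (forall b, exists a n, b * phi (f ^+ n) = phi a)
    & forall a b, phi a = phi b -> exists n, f ^+ n * a = f ^+ n * b].

(* An isomorphism of the open subspace [U] with the spectrum of a ring: the
   structure sheaf of a spectrum is the sheaf whose sections over each basic
   open set [D(f)] are the localization of [A] at [f]. The restriction maps
   between basic open sets are then determined, because they are morphisms of
   [A]-algebras. *)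
Record affine_chart (X : ringed_space) (U : opens X) := AffineChart {
  chart_ring : comPzRingType;
  chart : spec chart_ring -> X;
  chart_inj : injective chart;
  chart_continuous : continuous chart;
  chart_open : forall W : set (spec chart_ring), open W -> open (chart @` W);
  chart_range : range chart = U;
  chart_section : {rmorphism chart_ring -> sections U};
  chart_localization : forall (f : chart_ring) (V : opens X) (VU : V `<=` U),
    V = chart @` basic_open f :> set X ->
    is_localization f (res VU \o chart_section) }.

Definition affine (X : ringed_space) (U : opens X) :=
  inhabited (affine_chart U).

(* The structure morphism to the spectrum of [k] is given by the morphism of
   rings from [k] to the global sections. *)
Record scheme (k : fieldType) := Scheme {
  sch_rs :> ringed_space;
  sch_affine : forall x : sch_rs, exists2 U : opens sch_rs, oset U x & affine U;
  sch_str : {rmorphism k -> sections (opensT sch_rs)} }.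

Definition scalar_section (k : fieldType) (X : scheme k) (U : opens X) (c : k) :
  sections U := res (@subsetT _ U : U `<=` opensT X) (sch_str X c).

(* Morphisms of [k]-schemes. The comorphism is presented by maps
   [O_Y(V) -> O_X(U)] for all [U] inside the preimage of [V], rather than for
   the preimage itself, so that the comorphisms of pointwise equal maps have
   the same type. *)
Record sch_morphism (k : fieldType) (X Y : scheme k) := Morphism {
  mor :> X -> Y;
  mor_continuous : continuous mor;
  comor : forall (V : opens Y) (U : opens X), U `<=` mor @^-1` V ->
    {rmorphism sections V -> sections U};
  comor_res : forall (V V' : opens Y) (U U' : opens X)
    (UV : U `<=` mor @^-1` V) (UV' : U' `<=` mor @^-1` V')
    (VV : V' `<=` V) (UU : U' `<=` U) (s : sections V),
    res UU (comor UV s) = comor UV' (res VV s);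
  comor_local : forall (V : opens Y) (U : opens X) (UV : U `<=` mor @^-1` V)
    (s : sections V) (x : X), oset U x ->
    germ_unit x (comor UV s) -> germ_unit (mor x) s;
  comor_scalar : forall (V : opens Y) (U : opens X) (UV : U `<=` mor @^-1` V)
    (c : k), comor UV (scalar_section V c) = scalar_section U c }.

Arguments mor_continuous {k X Y}.

Section category.
Variable k : fieldType.

Section identity.
Variable X : scheme k.

Let id_comor (V U : opens X) (UV : U `<=` id @^-1` V) :
  {rmorphism sections V -> sections U} := res (UV : U `<=` V).

Let id_continuous : continuous (@id X). Proof. by move=> x. Qed.

Let id_comor_res (V V' U U' : opens X) (UV : U `<=` id @^-1` V)
    (UV' : U' `<=` id @^-1` V') (VV : V' `<=` V) (UU : U' `<=` U)
    (s : sections V) :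
  res UU (id_comor UV s) = id_comor UV' (res VV s).
Proof.
have U'V : U' `<=` V by exact: subset_trans UV.
by rewrite (res_res UV UU U'V) (res_res VV UV' U'V).
Qed.

Let id_comor_local (V U : opens X) (UV : U `<=` id @^-1` V) (s : sections V)
  (x : X) : oset U x -> germ_unit x (id_comor UV s) -> germ_unit (id x) s.
Proof.
move=> Ux [W [WU [Wx]]]; have WV : W `<=` V by exact: subset_trans UV.
by rewrite (res_res UV WU WV) => sW; exists W, WV.
Qed.

Let id_comor_scalar (V U : opens X) (UV : U `<=` id @^-1` V) (c : k) :
  id_comor UV (scalar_section V c) = scalar_section U c.
Proof. exact: res_res. Qed.

Definition sch_id : sch_morphism X X :=
  Morphism id_continuous id_comor_res id_comor_local id_comor_scalar.

End identity.

Section composition.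
Variables (X Y Z : scheme k) (g : sch_morphism Y Z) (f : sch_morphism X Y).

Let comp_comor (V : opens Z) (U : opens X) (UV : U `<=` (g \o f) @^-1` V) :
    {rmorphism sections V -> sections U} :=
  comor (UV : U `<=` f @^-1` opens_preimage (mor_continuous g) V)
  \o comor (@subset_refl _ _ : opens_preimage (mor_continuous g) V
                                 `<=` g @^-1` V).

Let comp_continuous : continuous (g \o f).
Proof.
by move=> x; apply: continuous_comp; exact: mor_continuous.
Qed.

Let comp_comor_res (V V' : opens Z) (U U' : opens X)
    (UV : U `<=` (g \o f) @^-1` V) (UV' : U' `<=` (g \o f) @^-1` V')
    (VV : V' `<=` V) (UU : U' `<=` U) (s : sections V) :
  res UU (comp_comor UV s) = comp_comor UV' (res VV s).
Proof.
rewrite /comp_comor /=.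
set gV := opens_preimage _ V; set gV' := opens_preimage _ V'.
have VV1 : gV' `<=` gV by move=> y; exact: VV.
rewrite (comor_res (UV : U `<=` f @^-1` gV) (UV' : U' `<=` f @^-1` gV') VV1).
congr (comor _ _); exact: comor_res.
Qed.

Let comp_comor_local (V : opens Z) (U : opens X)
    (UV : U `<=` (g \o f) @^-1` V) (s : sections V) (x : X) :
  oset U x -> germ_unit x (comp_comor UV s) -> germ_unit ((g \o f) x) s.
Proof.
move=> Ux /(comor_local Ux) sfx; apply: comor_local sfx; exact: UV.
Qed.

Let comp_comor_scalar (V : opens Z) (U : opens X)
    (UV : U `<=` (g \o f) @^-1` V) (c : k) :
  comp_comor UV (scalar_section V c) = scalar_section U c.
Proof. by rewrite /comp_comor /= !comor_scalar. Qed.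

Definition sch_comp : sch_morphism X Z :=
  Morphism comp_continuous comp_comor_res comp_comor_local comp_comor_scalar.

End composition.

End category.

(* A product of [k]-schemes, i.e., a fibre product over the spectrum of [k]. *)
Definition is_product (k : fieldType) (X Y P : scheme k)
    (p : sch_morphism P X) (q : sch_morphism P Y) :=
  forall (T : scheme k) (a : sch_morphism T X) (b : sch_morphism T Y),
    exists! h : sch_morphism T P, sch_comp p h = a /\ sch_comp q h = b.

Definition closed_immersion (k : fieldType) (X Y : scheme k)
    (i : sch_morphism X Y) :=
  [/\ injective i,
      (forall C : set X, closed C -> closed (i @` C))
    & forall (V : opens Y) (U : opens X) (UV : U `<=` i @^-1` V)
        (s : sections U) (y : Y), U = i @^-1` V :> set X -> oset V y ->
      exists (W : opens Y) (WV : W `<=` V) (U' : opens X) (U'U : U' `<=` U)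
        (U'W : U' `<=` i @^-1` W) (t : sections W),
        [/\ oset W y, U' = i @^-1` W :> set X & comor U'W t = res U'U s]].

Definition separated (k : fieldType) (X : scheme k) :=
  exists (P : scheme k) (p q : sch_morphism P X) (diag : sch_morphism X P),
    [/\ is_product p q, sch_comp p diag = sch_id X,
        sch_comp q diag = sch_id X & closed_immersion diag].

Definition fg_sections (k : fieldType) (X : scheme k) (U : opens X) :=
  exists (n : nat) (g : 'I_n -> sections U),
    forall S : {pred sections U}, subring_closed S ->
      (forall c, scalar_section U c \in S) -> (forall i, g i \in S) ->
      forall s, s \in S.

Definition finite_type (k : fieldType) (X : scheme k) :=
  exists (n : nat) (U : 'I_n -> opens X),
    \bigcup_i U i = [set: X] /\
    forall i, affine (U i) /\ fg_sections (U i).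

Definition reduced (X : ringed_space) :=
  forall (U : opens X) (s : sections U) (n : nat), s ^+ n = 0 -> s = 0.

Definition irreducible (X : topologicalType) :=
  [set: X] !=set0 /\
  forall A B : set X, closed A -> closed B -> A `|` B = setT ->
    A = setT \/ B = setT.

Record variety (k : fieldType) := Variety {
  var_scheme :> scheme k;
  var_irreducible : irreducible var_scheme;
  var_reduced : reduced var_scheme;
  var_separated : separated var_scheme;
  var_finite_type : finite_type var_scheme }.

Definition generic_point (X : topologicalType) (eta : X) :=
  closure [set eta] = setT.

Definition generic_sequence (X : topologicalType) (x : nat -> X) :=
  forall s : nat -> nat, {homo s : i j / (i < j)%N} -> dense (range (x \o s)).

(* Finite unions of locally closed sets. This is the right notion for
   noetherian spaces only. *)
Definition constructible (X : topologicalType) : set (set X) :=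
  [set C | exists (n : nat) (U Z : 'I_n -> set X),
    [/\ forall i, open (U i), forall i, closed (Z i)
      & C = \bigcup_i (U i `&` Z i)]].

Definition constructible_space (k : fieldType) (X : variety k) : Type := X.

Section constructible_topology.
Variables (k : fieldType) (X : variety k).

(* An arbitrary base point, which measurable types require. *)
Let base_point : X := projT1 (cid (proj1 (var_irreducible X))).

HB.instance Definition _ := Choice.on (constructible_space X).
HB.instance Definition _ := isPointed.Build (constructible_space X) base_point.
HB.instance Definition _ := isSubBaseTopological.Build (constructible_space X)
  (@constructible X) id.

End constructible_topology.

Definition borel (T : ptopologicalType) := g_sigma_algebraType (@open T).

HB.instance Definition _ (T : ptopologicalType) := Measurable.on (borel T).

Section radon.
Variables (T : ptopologicalType) (R : realType).
Local Open Scope ereal_scope.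

(* Meant for compact Hausdorff (or locally compact Hausdorff) spaces. *)
Record radon_measure := RadonMeasure {
  radon_mu :> {measure set (borel T) -> \bar R};
  radon_compact : forall K : set T, compact K -> radon_mu K < +oo;
  radon_outer : forall B : set (borel T), measurable B ->
    radon_mu B =
    ereal_inf [set radon_mu U | U in [set U : set T | open U /\ B `<=` U]];
  radon_inner : forall U : set T, open U ->
    radon_mu U =
    ereal_sup [set radon_mu K | K in [set K : set T | compact K /\ K `<=` U]] }.

HB.instance Definition _ := gen_eqMixin radon_measure.
HB.instance Definition _ := gen_choiceMixin radon_measure.

Definition integrals (mu : radon_measure) :
    {ptws continuousType T R -> R} :=
  fun phi => (\int[radon_mu mu]_x (phi x))%R.

(* The weak-* topology, as the topology induced from pointwise convergence of
   functionals on continuous functions. *)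
HB.instance Definition _ :=
  Topological.copy radon_measure (initial_topology integrals).

End radon.

Section dirac_radon.
Variables (k : fieldType) (X : variety k) (R : realType).

Lemma variety_separate (x y : X) : x != y ->
  exists U : set X, open U /\ (U x /\ ~ U y \/ U y /\ ~ U x).
Proof.
move=> /eqP xy; have [U Ux [c]] := sch_affine x.
have [Uy|Uy] := pselect (oset U y); last first.
  by exists U; split; [exact: oset_open | left].
move: Ux Uy; rewrite -(chart_range c) => -[p _ px] [q _ qy].
have cD (f : chart_ring c) : open (chart (a:=c) @` basic_open f).
  apply/chart_open/zariski_openE; exists [set f].
  apply/seteqP; split => r /= rf.
    by move=> /(_ f erefl).
  by move=> rf'; apply: rf => _ ->.
have mem_cD f r : (chart (a:=c) @` basic_open f) (chart r) -> ~ ideal_of r f.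
  by move=> [r' r'f /chart_inj <-].
have [pq|/existsNP[f /not_implyP[pf qf]]] := pselect (p `<=` q).
  have [qp|/existsNP[f /not_implyP[qf pf]]] := pselect (q `<=` p).
    exfalso; apply: xy; rewrite -px -qy; congr chart.
    move: p q {px qy} pq qp => [p pP] [q qP] /= pq qp.
    have e : p = q by apply/seteqP.
    by case: q / e qP {pq qp} => qP; congr Spec; exact: Prop_irrelevance.
  exists (chart (a:=c) @` basic_open f); split => //; left; rewrite -px -qy.
  by split; [exists p | move=> /mem_cD].
exists (chart (a:=c) @` basic_open f); split => //; right; rewrite -px -qy.
by split; [exists q | move=> /mem_cD].
Qed.

Lemma constructible_open (C : set (constructible_space X)) :
  @constructible X C -> open C.
Proof.
move=> cC; exists [set C]; last by rewrite bigcup_set1.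
move=> _ ->; exists [fset C]%fset; first by move=> D /fset1P ->; exact/mem_set.
by rewrite set_fset1 bigcap_set1.
Qed.

Lemma constructible_locally_closed (U Z : set X) : open U -> closed Z ->
  constructible (U `&` Z).
Proof.
move=> oU cZ; exists 1, (fun=> U), (fun=> Z); split => //.
by apply/seteqP; split => [y UZy|y [_ _ UZy]] //; exists ord0.
Qed.

Lemma constructible_space_closed1 (x : constructible_space X) :
  closed [set x].
Proof.
rewrite -openC openE => y /= /eqP yx.
have [U [oU UyUx]] := variety_separate (yx : (y : X) != x).
have [C [cC Cy Cx]] : exists C : set X, [/\ constructible C, C y & ~ C x].
  case: UyUx => [[Uy Ux]|[Ux Uy]].
    exists U; split => //; rewrite -[U]setIT.
    by apply: constructible_locally_closed => //; exact: closedT.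
  exists (~` U); split; [|exact: Uy|by move/(_ Ux)].
  rewrite -[~` U]setTI; apply: constructible_locally_closed.
    exact: openT.
  exact: open_closedC.
rewrite /interior nbhsE; exists C.
  by split => //; exact: constructible_open.
by move=> z Cz zx; apply: Cx; rewrite -zx.
Qed.

Variable x : X.
Local Open Scope ereal_scope.

Let delta : {measure set (borel (constructible_space X)) -> \bar R} :=
  @dirac _ (borel (constructible_space X)) x R.

Let deltaE (A : set (constructible_space X)) : delta A = (x \in A)%:R%:E.
Proof. exact: diracE. Qed.

Let delta_compact (K : set (constructible_space X)) :
  compact K -> delta K < +oo.
Proof. by rewrite deltaE ltry. Qed.

Let delta_outer (B : set (borel (constructible_space X))) : measurable B ->
  delta B = ereal_inf [set delta U |
    U in [set U : set (constructible_space X) | open U /\ B `<=` U]].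
Proof.
move=> _; apply/eqP; rewrite eq_le; apply/andP; split.
  apply: le_ereal_inf_tmp => _ [U [_ BU] <-].
  rewrite !deltaE lee_fin ler_nat.
  by case: (boolP (x \in B)) => // /set_mem/BU/mem_set ->.
apply: ge_ereal_inf; have [Bx|Bx] := boolP (x \in B).
  exists (delta setT); first by exists setT => //; split => //; exact: openT.
  by rewrite !deltaE Bx in_setT.
exists (delta (~` [set x])).
  exists (~` [set x]) => //; split.
    exact/closed_openC/constructible_space_closed1.
  by move=> y By yx; move: Bx; rewrite notin_setE -yx; apply.
have xx : (x \in ~` [set x]) = false by rewrite memNset //= => xx; exact: xx.
by rewrite !deltaE (negbTE Bx) xx.
Qed.

Let delta_inner (U : set (constructible_space X)) : open U ->
  delta U = ereal_sup [set delta K |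
    K in [set K : set (constructible_space X) | compact K /\ K `<=` U]].
Proof.
move=> _; apply/eqP; rewrite eq_le; apply/andP; split; last first.
  apply: ge_ereal_sup => _ [K [_ KU] <-].
  rewrite !deltaE lee_fin ler_nat.
  by case: (boolP (x \in K)) => // /set_mem/KU/mem_set ->.
apply: le_ereal_sup_tmp; have [Ux|Ux] := boolP (x \in U).
  exists (delta [set x]); last by rewrite !deltaE Ux mem_set.
  exists [set x] => //; split; first exact: compact_set1.
  by move=> _ ->; exact: set_mem.
exists (delta set0); last by rewrite !deltaE (negbTE Ux) in_set0.
by exists set0 => //; split; [exact: compact0 | exact: sub0set].
Qed.

Definition dirac_radon : radon_measure (constructible_space X) R :=
  RadonMeasure delta_compact delta_outer delta_inner.

End dirac_radon.

(* Main.v *)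
(* Integrating against a Dirac measure is evaluation, and the indicator function
   of a Zariski open set is continuous for the constructible topology, so weak-*
   convergence to the Dirac measure at the generic point amounts to convergence
   to that point in the constructible topology. The neighbourhoods of the generic
   point there are generated by the nonempty Zariski open sets, so this says that
   the sequence is eventually in every nonempty open set. If it is not, the terms
   outside some nonempty open set form a subsequence that is not dense. *)

Require Import Defs.
From mathcomp Require Import all_boot all_order all_algebra.
From mathcomp Require Import all_classical all_reals all_analysis.
From mathcomp Require Import measurable_realfun.
Import Order.TTheory GRing.Theory Num.Theory.
Import numFieldNormedType.Exports.
Local Open Scope classical_set_scope.
Local Open Scope ring_scope.

(** Preimages under [f] of open sets form a base of the initial topology. *)
Lemma cvg_initialP (S : choiceType) (T : topologicalType) (f : S -> T)
    (F : set_system S) (s : S) : Filter F ->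
  F --> (s : initial_topology f) <-> f @ F --> f s.
Proof.
move=> FF; split=> [Fs|fFs A [_ [[B oB <-] Bfs] BA]].
  by move=> A /(@initial_continuous _ _ f s); exact: Fs.
by apply: filterS BA _; apply: fFs; exact: open_nbhs_nbhs.
Qed.

Lemma cvg_prod_topologyP (I : Type) (T : I -> topologicalType)
    (F : set_system (prod_topology T)) (f : prod_topology T) : Filter F ->
  F --> f <-> forall i, g i @[g --> F] --> f i.
Proof.
move=> FF; split=> [Ff i|Ff].
  apply/(cvg_initialP _ _ (fun g : forall i, T i => g i)).
  by move/cvg_sup : Ff; apply.
apply/cvg_sup => i.
exact/(cvg_initialP _ _ (fun g : forall i, T i => g i)).
Qed.

(** If [P] fails arbitrarily far out, its failures can be strung into a strictly increasing
    sequence. *)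
Lemma near_infty_subseq (P : set nat) :
  (\forall n \near \oo, P n) <->
  forall s : nat -> nat, {homo s : i j / (i < j)%N} -> exists i, P (s i).
Proof.
split=> [[N _ PN] s s_lt|sP].
  exists N; apply: PN => /=.
  elim: N => // N IH; exact: leq_ltn_trans IH (s_lt _ _ (ltnSn N)).
apply: contrapT => NP.
have /choice[f fP] : forall N, exists n, (N <= n)%N /\ ~ P n.
  move=> N; apply: contrapT => /forallNP Nn; apply: NP.
  exists N => // n /= Ln; apply: contrapT => Pn; exact: (Nn n).
(* The successor makes [s] strictly increasing; starting at [f 0] rather than [0] makes even the
   first term violate [P]. *)
pose s n := iter n (fun m => f m.+1) (f 0%N).
have [|i] := sP s.
  by apply: homo_ltn => [? ? ?|i]; [exact: ltn_trans|exact: (fP _).1].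
by case: i => [|i]; apply: (fP _).2.
Qed.

Lemma generic_sequenceP (X : topologicalType) (x : nat -> X) :
  generic_sequence x <->
  forall U : set X, open U -> U !=set0 -> \forall n \near \oo, U (x n).
Proof.
split=> [xgen U oU U0|xU s s_lt U U0 oU].
  apply/near_infty_subseq => s s_lt.
  have [y [Uy [i _ xi]]] := xgen s s_lt U U0 oU.
  by exists i; move: Uy; rewrite -xi.
have [/(_ (xU U oU U0)) sU _] := near_infty_subseq (fun n => U (x n)).
by have [i Ui] := sU s s_lt; exists (x (s i)); split => //; exists i.
Qed.

Lemma generic_pointP (X : topologicalType) (eta : X) :
  generic_point eta -> forall U : set X, open U -> U !=set0 -> U eta.
Proof.
move=> eta_gen U oU [y Uy].
have : closure [set eta] y by rewrite eta_gen.
by move=> /(_ U (open_nbhs_nbhs (conj oU Uy))) [_ [->]].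
Qed.

Lemma clopen_indic_continuous (T : topologicalType) (R : realType)
  (U : set T) : clopen U -> continuous (\1_U : T -> R).
Proof.
move=> [oU cU] y; have [Uy|nUy] := pselect (U y).
  apply: (near_cst_continuous (1 : R)).
  have := open_nbhs_nbhs (conj oU Uy); apply: filterS => z Uz.
  by rewrite indicE mem_set.
apply: (near_cst_continuous (0 : R)).
have := open_nbhs_nbhs (conj (closed_openC cU) nUy); apply: filterS => z Uz.
by rewrite indicE memNset.
Qed.

(** Open intervals generate the measurable sets of [R], and their preimages are open, hence
    Borel. *)
Lemma continuous_borel_measurable (T : ptopologicalType) (R : realType)
  (phi : T -> R) : continuous phi ->
  measurable_fun [set: borel T] (phi : borel T -> R).
Proof.
move=> cphi.
apply: (measurability (@RGenOpens.G R)).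
  exact: RGenOpens.measurableE.
move=> _ [_ [a [b ->]] <-]; rewrite setTI; apply: sub_sigma_algebra.
by move/continuousP: cphi; apply; exact: interval_open.
Qed.

(** The weak-* topology is initial for [integrals], whose target carries a product topology, where
    convergence is coordinatewise. *)
Lemma cvg_radonP (T : ptopologicalType) (R : realType)
    (F : set_system (radon_measure T R)) (mu : radon_measure T R) : Filter F ->
  F --> mu <->
  forall phi : continuousType T R,
    integrals nu phi @[nu --> F] --> integrals mu phi.
Proof.
move=> FF; apply: (iff_trans (cvg_initialP _ _ (@integrals T R) F mu FF)).
exact: cvg_prod_topologyP.
Qed.

Section constructible.
Variables (k : fieldType) (X : variety k).

(** Both [U] and its complement are Zariski locally closed, hence constructible. *)
Lemma open_constructible_clopen (U : set X) : open U ->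
  clopen (U : set (constructible_space X)).
Proof.
move=> oU; split.
  apply: constructible_open; rewrite -[U]setIT.
  by apply: constructible_locally_closed => //; exact: closedT.
rewrite -openC; apply: constructible_open; rewrite -[~` U]setTI.
apply: constructible_locally_closed; first exact: openT.
exact: open_closedC.
Qed.

(* A locally closed set containing the generic point is open, because the only
   closed set containing that point is the whole space. *)
Lemma constructible_generic_open (eta : X) (C : set X) : generic_point eta ->
  constructible C -> C eta -> exists U : set X, [/\ open U, U eta & U `<=` C].
Proof.
move=> eta_gen [n [U [Z [oU cZ ->]]]] [i _ [Ui Zi]].
exists (U i); split => // y Uy; exists i => //; split => //.
have : closure [set eta] y by rewrite eta_gen.
by move/(closureS (_ : [set eta] `<=` Z i)); rewrite -(closure_id _).1 //;
  apply => _ ->.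
Qed.

Lemma cvg_constructible_generic (eta : X) (x : nat -> X) : generic_point eta ->
  (x @ \oo --> (eta : constructible_space X)) <-> generic_sequence x.
Proof.
move=> eta_gen; rewrite generic_sequenceP; split=> [xeta U oU U0|xU W].
  apply: xeta; apply: (@open_nbhs_nbhs (constructible_space X)); split.
    by have [] := open_constructible_clopen U oU.
  exact: generic_pointP U0.
(* The neighbourhood contains a basic set [A] around [eta], a finite intersection of constructible
   sets, so each factor [C] can be treated separately. *)
rewrite nbhsE => -[B [[F FI <-] [A FA Aeta]] BW].
have [D Dcons AD] := FI _ FA.
apply: (@filterS _ _ _ A) => [y Ay|]; first by apply: BW; exists A.
rewrite -AD; apply: filter_bigI => C CD.
have /set_mem Ccons := Dcons _ CD.
have Ceta : C eta by rewrite -AD in Aeta; exact: Aeta.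
have [U [oU Ueta UC]] := constructible_generic_open eta C eta_gen Ccons Ceta.
by apply: filterS (xU U oU _); [move=> n; exact: UC|exists eta].
Qed.

Variable R : realType.

Lemma integrals_dirac (x : X)
    (phi : continuousType (constructible_space X) R) :
  integrals (dirac_radon R x) phi = phi x.
Proof.
rewrite /integrals /Rintegral /= integral_dirac //; last first.
  apply/measurable_EFinP; apply: continuous_borel_measurable.
  exact: cts_fun.
by rewrite diracT mul1e.
Qed.

Lemma cvg_dirac_radonP (x : nat -> X) (y : X) :
  (fun n => dirac_radon R (x n)) @ \oo --> dirac_radon R y <->
  forall phi : continuousType (constructible_space X) R,
    phi (x n) @[n --> \oo] --> phi y.
Proof.
have intE (phi : continuousType (constructible_space X) R) :
  phi \o x = (fun mu => integrals mu phi) \o (fun n => dirac_radon R (x n)).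
  by apply/funext => n; rewrite /= integrals_dirac.
rewrite cvg_radonP; split=> xy phi.
  change (phi \o x @ \oo --> phi y).
  by rewrite intE -integrals_dirac; exact: xy.
change ((fun mu => integrals mu phi) \o (fun n => dirac_radon R (x n)) @ \oo
  --> integrals (dirac_radon R y) phi).
by rewrite -intE integrals_dirac; exact: xy.
Qed.

End constructible.

Theorem corollary1p14 (R : realType) (k : closedFieldType) (X : variety k)
    (eta : X) (eta_generic : generic_point eta) (x : nat -> X) :
  generic_sequence x <->
  (fun n => dirac_radon R (x n)) @ \oo --> dirac_radon R eta.
Proof.
rewrite cvg_dirac_radonP; split=> [xgen phi|xphi].
  have /(cvg_constructible_generic _ _ _ _ eta_generic) xeta := xgen.
  have phic : continuous (phi : constructible_space X -> R) by exact: cts_fun.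
  by move=> V /(phic (eta : constructible_space X)); exact: xeta.
apply/generic_sequenceP => U oU U0.
have cU := clopen_indic_continuous _ R _ (open_constructible_clopen _ _ U oU).
(* The limit is 1, so the values are eventually positive; an indicator is positive only on its
   set. *)
have /cvgr_gt/(_ 0) : (\1_U (x n) : R) @[n --> \oo] --> (\1_U eta : R).
  exact: (xphi (mkcts cU)).
rewrite {1}indicE (mem_set (generic_pointP _ _ eta_generic U oU U0)).
move=> /(_ ltr01); apply: filterS => n; rewrite indicE.
by case: (boolP (x n \in U)) => [/set_mem //|_]; rewrite ltxx.
Qed.
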